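(* A regular space $X$ is minimal regular ($MR$) if and only if $X$ is $R$-closed and the following holds: for every infinite set $A\subseteq X$, writing $B$ for the set of all $\theta(\omega)$-accumulation points of $A$, if $x\in B$ is a point such that $A$ does not $\theta(\omega)$-converge to $X\setminus\{x\}$, then $x$ is a complete accumulation point of $A$.
   Context: Regular spaces are assumed Hausdorff; all neighborhoods are open; $\mathrm{cl}\,M=\overline M$ is the closure in $X$. An $R$-closed space is a regular space that is closed in every regular space containing it as a subspace. A regular space is $MR$ (minimal regular) if its underlying set carries no strictly coarser regular topology. A neighborhood $U$ of a point $x$ is an $\omega$-hull of $x$ if there is a sequence of neighborhoods $\{U_i\}_{i=1}^\infty$ of $x$ with $\mathrm{cl}\,U_i\subseteq U_{i+1}$ and $U_i\subseteq U$ for every $i$. A point $x\in X$ is a $\theta(\omega)$-accumulation point of an infinite set $F$ if $|F\cap U|=|F|$ for every $\omega$-hull $U$ of $x$. It is a complete accumulation point of $F$ if $|F\cap U|=|F|$ for every neighborhood $U$ of $x$. For a set $B\subseteq X$, an open cover of $B$ is a family of open subsets of $X$ whose union contains $B$. An open cover $\mathcal V$ is a shrinkable refinement of an open cover $\mathcal U$ if for each $V\in\mathcal V$ there is $U\in\mathcal U$ with $\overline V\subseteq U$. An open cover $\mathcal V$ is a regular refinement of $\mathcal U$ if $\mathcal V$ refines $\mathcal U$ and $\mathcal V$ is a shrinkable refinement of itself. An open cover of $B$ is regular if it has a regular refinement that is an open cover of $B$. A set $A$ $\theta(\omega)$-converges to a set $B$ if for every regular cover $\gamma$ of $B$ there is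 a finite family $\{U_{\alpha_i}\}_{i=1}^s\subseteq\gamma$ such that $|A\setminus\bigcup_{i=1}^s U_{\alpha_i}|<|A|$. *)

(* Defs.v *)
From HB Require Import structures.
From mathcomp Require Import all_boot.
From mathcomp Require Import boolp classical_sets functions cardinality topology.
Set Implicit Arguments.
Unset Strict Implicit.
Unset Printing Implicit Defensive.

Local Open Scope classical_set_scope.
Local Open Scope card_scope.

Definition card_lt (T U : Type) (A : set T) (B : set U) : Prop :=
  (A #<= B) && ~~ (B #<= A).

Definition regular_hausdorff (X : topologicalType) : Prop :=
  regular_space X /\ hausdorff_space X.

(* [f] is an embedding: injective, and [X] carries the topology induced by [f].
   Up to the identification of [X] with [range f], this says that [X] is a
   subspace of [Y]. *)
Definition topological_embedding (X Y : topologicalType) (f : X -> Y) : Prop :=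
  injective f /\ @open X = [set f @^-1` V | V in @open Y].

Definition R_closed (X : topologicalType) : Prop :=
  regular_hausdorff X /\
  forall (Y : topologicalType) (f : X -> Y),
    regular_hausdorff Y -> topological_embedding f -> closed (range f).

(* [tau : Topological X] ranges over all topologies on the carrier of [X];
   [Topological.Pack tau] is that carrier equipped with [tau]. *)
Definition minimal_regular (X : topologicalType) : Prop :=
  regular_hausdorff X /\
  ~ exists tau : Topological X,
      regular_hausdorff (Topological.Pack tau) /\
      @open (Topological.Pack tau) `<` @open X.

Section RegularCovers.
Context {X : topologicalType}.
Implicit Types (x : X) (A B F U : set X) (C D : set (set X)).

(* As [open_nbhs x U] means that [U] is open and contains [x], all the
   neighborhoods below are open. *)
Definition omega_hull x U : Prop :=
  open_nbhs x U /\
  exists V : nat -> set X, forall i,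
    [/\ open_nbhs x (V i), closure (V i) `<=` V i.+1 & V i `<=` U].

Definition theta_omega_accumulation F x : Prop :=
  forall U, omega_hull x U -> F `&` U #= F.

Definition complete_accumulation F x : Prop :=
  forall U, open_nbhs x U -> F `&` U #= F.

Definition open_cover B C : Prop :=
  C `<=` open /\ B `<=` \bigcup_(U in C) U.

Definition refines D C : Prop :=
  forall V, D V -> exists2 U, C U & V `<=` U.

Definition shrinkable_refinement D C : Prop :=
  forall V, D V -> exists2 U, C U & closure V `<=` U.

Definition regular_refinement D C : Prop :=
  refines D C /\ shrinkable_refinement D D.

Definition regular_cover B C : Prop :=
  open_cover B C /\ exists D, open_cover B D /\ regular_refinement D C.

Definition theta_omega_converges A B : Prop :=
  forall C, regular_cover B C ->
    exists D, [/\ D `<=` C, finite_set D &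
      card_lt (A `\` \bigcup_(U in D) U) A].

End RegularCovers.

(* Main.v *)
(* Regularity of covers and of topologies is expressed by regular filters: filters
   in which every member contains the closure of an open member. Declaring a
   regular filter E to be (or to coarsen) the neighborhood filter of one point
   gives a regular topology as soon as E clusters at no other point. With a new
   point this shows that in an R-closed space every proper regular filter
   clusters; with an old point p it shows that in an MR space a regular filter
   clustering at most at p converges to p. A regular cover of X \ {x} on which
   A fails to converge yields, through the complements of finite unions, a
   regular filter clustering at most at x, whence one direction. Conversely, for
   a strictly coarser regular topology take a point p with a neighborhood U that
   is not a neighborhood of p in the coarser topology, let E be the coarser
   neighborhood filter of p, and let A be a set of least cardinality among the
   G \ U with G in E: then |A /\ G| = |A| for every G in E, so that p and A
   violate the condition. *)

Require Import Defs.
From HB Require Import structures.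
From mathcomp Require Import all_boot.
From mathcomp Require Import boolp classical_sets functions cardinality topology.

Set Implicit Arguments.
Unset Strict Implicit.

Local Open Scope classical_set_scope.
Local Open Scope card_scope.

(* By Zorn, take a maximal family of choice functions of [S] that differ pairwise
   at every index; by maximality it exhausts some [S i], and it injects into
   every [S j]. *)
Lemma card_le_minimum (I T : Type) (S : I -> set T) :
  I -> exists i, forall j, S i #<= S j.
Proof.
move=> i0.
pose P (F : set (I -> T)) := (forall t i, F t -> S i (t i)) /\
  (forall t u i, F t -> F u -> t i = u i -> t = u).
have [C CP totC|F [[FS Finj] Fmax]] := @Zorn_bigcup _ P.
  split=> [t i [F CF Ft]|t u i [F CF Ft] [G CG Gu] tu]; first exact: (CP F CF).1.
  have [FG|GF] := totC _ _ CF CG.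
    by apply: (CP G CG).2 tu => //; exact: FG.
  by apply: (CP F CF).2 tu => //; exact: GF.
have [i Si] : exists i, S i `<=` [set t i | t in F].
  apply: contrapT => /forallNP noi.
  have /choice[t tP] : forall i, exists y, S i y /\ ~ [set t i | t in F] y.
    by move=> i; have /existsNP[y /not_implyP] := noi i; exists y.
  apply: (Fmax (F `|` [set t])).
    split=> [|tF]; first by left.
    by have [_] := tP i0; apply; exists t => //; apply: tF; right.
  split=> [u i [/FS//|->]|u v i [Fu|->] [Fv|->]//]; first by have [] := tP i.
  - exact: Finj.
  - by move=> uv; have [_ []] := tP i; exists u.
  - by move=> uv; have [_ []] := tP i; exists v.
exists i => j.
apply: (card_le_trans (subset_card_le Si)).
apply: (card_le_trans (card_image_le _ _)).
have /card_le_eql <- : [set t j | t in F] #= F.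
  by apply: inj_card_eq => t u /set_mem Ft /set_mem Fu; exact: Finj.
by apply: subset_card_le => _ [t Ft <-]; exact: FS.
Qed.

Lemma filter_bigcap_finite (T : Type) (I : choiceType) (D : set I)
    (g : I -> set T) (F : set_system T) : Filter F ->
  finite_set D -> (forall i, D i -> F (g i)) -> F (\bigcap_(i in D) g i).
Proof. by move=> FF /finite_fsetP[s ->]; exact: filter_bigI. Qed.

(** * Regular spaces and regular filters *)

Section Regularity.
Context {X : topologicalType}.

Lemma closure_subset_closed (A B : set X) :
  closed B -> A `<=` B -> closure A `<=` B.
Proof. by move=> /closure_id cB /closureS; rewrite -cB. Qed.

Lemma regular_open_nbhs (x : X) (A : set X) : regular_space X -> nbhs x A ->
  exists V, open_nbhs x V /\ closure V `<=` A.
Proof.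
move=> regX /regX[V]; rewrite nbhsE => -[W xW WV] VA.
by exists W; split=> //; apply: subset_trans VA; exact: closureS.
Qed.

Lemma regular_hausdorffP : (forall x : X, closed [set x]) ->
  (forall (x : X) A, open_nbhs x A -> exists V, open_nbhs x V /\ closure V `<=` A) ->
  regular_hausdorff X.
Proof.
move=> T1 regX; split.
  move=> x A; rewrite nbhs_simpl nbhsE => -[B xB BA].
  have [V [xV VB]] := regX _ _ xB.
  by exists V; [exists V|exact: subset_trans BA].
move=> x y xy; apply: contrapT => xNy.
have [|V [xV Vy]] := regX x (~` [set y]).
  by split=> //; exact/closed_openC/T1.
have /Vy : closure V y by move=> B yB; exact: xy (open_nbhs_nbhs xV) yB.
exact.
Qed.

Lemma regular_hausdorff_closed1 (x : X) :
  regular_hausdorff X -> closed [set x].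
Proof. by case=> _ /hausdorff_accessible/accessible_closed_set1. Qed.

Definition regular_filter (E : set_system X) :=
  forall A, E A -> exists V, [/\ open V, E V & closure V `<=` A].

Lemma regular_filter_interior (E : set_system X) (A : set X) : Filter E ->
  regular_filter E -> E A -> E A°.
Proof.
move=> FE regE /regE[V [oV EV VA]]; apply: filterS EV.
by rewrite -open_subsetE//; apply: subset_trans VA; exact: subset_closure.
Qed.

Lemma not_clusterP (E : set_system X) (x : X) : regular_filter E ->
  ~ cluster E x -> exists V, [/\ open V, E V & ~ closure V x].
Proof.
move=> regE; rewrite clusterE => /existsNP[A /not_implyP[EA Ax]].
have [V [oV EV VA]] := regE _ EA; exists V; split=> // /VA xA.
by apply: Ax; exact: subset_closure.
Qed.

End Regularity.

(** * Gluing a regular filter to a point *)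

(* [Y] with the final topology for [f], except that the neighborhoods of [p] must
   have their preimage in [E]; used with [f = id] and with [f = Some]. *)
Definition glued {X : Type} {Y : choiceType} (f : X -> Y) (p : Y)
  (E : set_system X) of Filter E : Type := Y.

Section Glued.
Context {X : topologicalType} {Y : choiceType} (f : X -> Y) (p : Y).
Context (E : set_system X) (FE : Filter E).

Local Notation Z := (glued f p FE).

HB.instance Definition _ := Choice.on Z.

Definition glued_open (W : set Z) :=
  open (f @^-1` W) /\ (W p -> E (f @^-1` W)).

Let glued_openT : glued_open setT.
Proof. by split=> [|_]; [exact: openT|exact: filterT]. Qed.

Let glued_openI : setI_closed glued_open.
Proof.
move=> A B [oA EA] [oB EB]; split; first exact: openI.
by move=> [/EA ? /EB ?]; exact: filterI.
Qed.

Let glued_open_bigU (I : Type) (g : I -> set Z) :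
  (forall i, glued_open (g i)) -> glued_open (\bigcup_i g i).
Proof.
move=> og; split; first by apply: bigcup_open => i _; exact: (og i).1.
move=> [i _ /((og i).2)]; apply: filterS => x gix.
by exists i.
Qed.

HB.instance Definition _ :=
  isOpenTopological.Build Z glued_openT glued_openI glued_open_bigU.

Lemma glued_openE : @open Z = glued_open.
Proof. by []. Qed.

Hypotheses (f_inj : injective f) (f_onto : forall y, y = p \/ exists x, f x = y).
Hypotheses (X_rh : regular_hausdorff X) (E_reg : regular_filter E).
Hypothesis E_cvg : forall x, f x = p -> E `<=` nbhs x.
Hypothesis E_cluster : forall x, cluster E x -> f x = p.

Let closed_glued (W : set Z) :
  closed (f @^-1` W) -> (W p \/ E (~` (f @^-1` W))) -> closed W.
Proof.
move=> cW Wp; rewrite -(setCK W); apply: open_closedC.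
rewrite glued_openE; split; first exact: closed_openC.
by move=> nWp; case: Wp => // ?.
Qed.

Let preimage_image (A : set X) : f @^-1` (f @` A) = A.
Proof. by apply/seteqP; split=> [x [y Ay /f_inj<-]//|x Ax]; exists x. Qed.

(** At [p], closed neighborhoods come from [E_reg]. Any other point is no cluster point of [E], so
    it has a neighborhood off some [closure V] with [V] in [E], and closed sets of [X] inside that
    neighborhood stay closed in [Z]. *)
Lemma glued_regular_hausdorff : regular_hausdorff Z.
Proof.
apply: regular_hausdorffP.
  move=> y; have [->|[x fx]] := f_onto y.
    apply: closed_glued; last by left.
    have [[x fx]|noX] := pselect (exists x, f x = p).
      rewrite (_ : _ @^-1` _ = [set x]); first exact: regular_hausdorff_closed1.
      by apply/seteqP; split=> [z /=|z ->//]; rewrite -fx => /f_inj.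
    rewrite (_ : _ @^-1` _ = set0); first exact: closed0.
    by apply/seteqP; split=> // x fx; apply: noX; exists x.
  have -> : [set y] = f @` [set x] by rewrite image_set1 fx.
  apply: closed_glued; rewrite preimage_image; first exact: regular_hausdorff_closed1.
  have [xp|xp] := pselect (f x = p); first by left; exists x.
  right; have [V [_ EV Vx]] := not_clusterP E_reg (fun h => xp (E_cluster h)).
  by apply: filterS EV => z Vz zx; apply: Vx; rewrite -zx; exact: subset_closure.
move=> y W [[oW EW] Wy]; have [yp|yp] := pselect (y = p).
  subst y; have [V [oV EV VW]] := E_reg (EW Wy).
  pose W' : set Z := [set p] `|` f @` V.
  have fW' : f @^-1` W' = V.
    rewrite preimage_setU preimage_image; apply/seteqP; split=> [x [|//]|x]; last by right.
    (* When [p] is already a point of [X], [E_cvg] puts it in [V]. *)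
    by move=> /= fx; apply: nbhs_singleton; exact: (E_cvg fx EV).
  exists W'; split.
    by split; [rewrite glued_openE /glued_open fW'|left].
  have cW' : closed ([set p] `|` f @` closure V : set Z).
    apply: closed_glued; last by left; left.
    rewrite preimage_setU preimage_image setUidr; first exact: closed_closure.
    by move=> x /= fx; apply/subset_closure; exact: nbhs_singleton (E_cvg fx EV).
  apply: (@subset_trans _ ([set p] `|` f @` closure V)).
    apply: closure_subset_closed cW' _.
    by apply: setUS; exact/image_subset/subset_closure.
  by move=> _ [->//|[x /VW + <-]].
have [//|[x fx]] := f_onto y; subst y.
have [V [oV EV Vx]] := not_clusterP E_reg (fun h => yp (E_cluster h)).
have /regular_open_nbhs[|N [[oN Nx] NWV]] : nbhs x (f @^-1` W `&` ~` closure V).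
- by apply: open_nbhs_nbhs; split=> //; apply: openI => //; exact/closed_openC/closed_closure.
- exact: X_rh.1.
exists (f @` N); split.
  split; last by exists x.
  rewrite glued_openE; split; first by rewrite preimage_image.
  move=> [z Nz fz]; apply: contrapT => _.
  have [_] : (f @^-1` W `&` ~` closure V) z by apply/NWV/subset_closure.
  by apply; apply/subset_closure; exact: nbhs_singleton (E_cvg fz EV).
have cN : closed (f @` closure N : set Z).
  apply: closed_glued; rewrite preimage_image; first exact: closed_closure.
  right; apply: filterS EV => z Vz /NWV[_]; apply.
  exact: subset_closure.
apply: (@subset_trans _ (f @` closure N)).
  apply: closure_subset_closed cN _.
  exact/image_subset/subset_closure.
by move=> _ [z /NWV[+ _] <-].
Qed.

End Glued.

(** * Cluster points in R-closed and in minimal regular spaces *)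

(** Otherwise a new point [None] whose neighborhoods trace [E] on [X] gives a regular extension of
    [X], in which [X] is not closed as [E] is proper. *)
Lemma R_closed_cluster (X : topologicalType) (E : set_system X) :
  ProperFilter E -> R_closed X -> regular_filter E -> exists x, cluster E x.
Proof.
move=> PE [X_rh X_cl] E_reg; apply: contrapT => /forallNP noE.
have FE : Filter E by exact: _.
pose Z := glued (Some : X -> option X) None FE.
have Z_rh : regular_hausdorff Z.
  apply: glued_regular_hausdorff => //.
  - by case=> [x|]; [right; exists x|left].
  - by move=> x /noE.
have /(X_cl Z Some Z_rh) cX : topological_embedding (Some : X -> Z).
  split; first by move=> ? ? [].
  apply/seteqP; split=> [U oU|_ [W [oW _] <-]//]; exists (Some @` U).
    rewrite glued_openE; split; last by case.
    rewrite (_ : _ @^-1` _ = U)//.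
    by apply/seteqP; split=> [x [y Uy [<-]]//|x Ux]; exists x.
  by apply/seteqP; split=> [x [y Uy [<-]]//|x Ux]; exists x.
have [_ /(_ _)] := closed_openC cX.
rewrite (_ : _ @^-1` _ = set0); last by apply/seteqP; split=> // x; apply; exists x.
by move=> E0; apply: (filter_not_empty E); apply: E0 => -[].
Qed.

Lemma minimal_regular_cvg (X : topologicalType) (E : set_system X) (p : X) :
  Filter E -> minimal_regular X -> regular_filter E ->
  cluster E `<=` [set p] -> nbhs p `<=` E.
Proof.
move=> FE [X_rh Xmin] E_reg Ep U pU; apply: contrapT => EU; apply: Xmin.
(* Gluing at an old point needs a filter coarser than [nbhs p]; the intersection still clusters at
   no other point. *)
pose E' := E `&` nbhs p.
have FE' : Filter E'.
  split; first by split; exact: filterT.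
    by move=> A B [? ?] [? ?]; split; exact: filterI.
  by move=> A B AB [? ?]; split; exact: filterS AB _.
have Z_rh : regular_hausdorff (glued id p FE').
  apply: glued_regular_hausdorff => //.
  - by move=> y; right; exists y.
  - move=> A [/E_reg[V [oV EV VA]] /(regular_open_nbhs X_rh.1)[W [[oW Wp] WA]]].
    exists (V `|` W); split; first exact: openU.
      split; first by apply: filterS EV => ? ?; left.
      by apply: open_nbhs_nbhs; split; [exact: openU|right].
    by rewrite closureU subUset.
  - by move=> x -> A [].
  - move=> x E'x; apply: contrapT => xp.
    have [V [oV EV Vx]] := not_clusterP E_reg (fun Ex => xp (Ep _ Ex)).
    have [W [pW Wx]] : exists W, open_nbhs p W /\ ~ closure W x.
      have [|W [pW Wx]] := @regular_open_nbhs _ p (~` [set x]) X_rh.1.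
        apply: open_nbhs_nbhs; split; last by move=> /= px; apply: xp.
        exact/closed_openC/regular_hausdorff_closed1.
      by exists W; split=> // /Wx; exact.
    have : closure (V `|` W) x.
      rewrite clusterE in E'x; apply: E'x; split.
        by apply: filterS EV => ? ?; left.
      by apply: filterS (open_nbhs_nbhs pW) => ? ?; right.
    by rewrite closureU => -[].
exists (Topological.class (glued id p FE')); split=> //.
split=> [W []//|opens].
have [_ /(_ _)] := opens U° (open_interior _).
by case=> // /filterS EU' _; apply: EU; apply: EU'; exact: interior_subset.
Qed.

(** A point [y] of the closure outside [range f] traces on [X] a proper regular filter without
    cluster points; by minimality it would converge to every point. *)
Lemma minimal_regular_R_closed (X : topologicalType) :
  minimal_regular X -> R_closed X.
Proof.
move=> Xmin; split=> [|Y f Y_rh [_ f_open]]; first exact: Xmin.1.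
have f_cont W : open W -> open (f @^-1` W) by rewrite f_open => oW; exists W.
have clf V : closure (f @^-1` V) `<=` f @^-1` closure V.
  apply: closure_subset_closed; last by move=> x /= Vx; exact: subset_closure.
  rewrite -(setCK (_ @^-1` _)); apply: open_closedC.
  by apply: (f_cont (~` closure V)); exact/closed_openC/closed_closure.
move=> y yf; apply: contrapT => fy.
pose E := filter_from (nbhs y) (fun W => f @^-1` W).
have FE : ProperFilter E.
  apply: filter_from_proper => [|W yW].
    apply: filter_from_filter; first by exists setT; exact: filterT.
    by move=> V W yV yW; exists (V `&` W) => //; exact: filterI.
  by have [_ [[x _ <-] ?]] := yf _ yW; exists x.
have E_reg : regular_filter E.
  move=> A [W /(regular_open_nbhs Y_rh.1)[V [yV VW]] WA].
  exists (f @^-1` V); split; first exact: f_cont yV.1.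
    by exists V => //; exact: open_nbhs_nbhs.
  by apply: subset_trans WA => x /clf /VW.
have noE x : ~ cluster E x.
  rewrite clusterE => Ex.
  have [|V [yV]] := @regular_open_nbhs _ y (~` [set f x]) Y_rh.1.
    apply: open_nbhs_nbhs; split; last by move=> /= yx; apply: fy; exists x.
    exact/closed_openC/regular_hausdorff_closed1.
  move=> /(_ (f x)); apply=> //; apply: clf; apply: Ex.
  by exists V => //; exact: open_nbhs_nbhs.
have [x _] := @filter_ex _ E FE setT filterT.
apply: (noE x) => A B EA xB; apply: (@filter_ex _ E); apply: filterI => //.
by apply: minimal_regular_cvg xB => // z /noE.
Qed.

(** * Filters from regular covers *)

Section CoverFilter.
Context {X : topologicalType} (D : set (set X)).

Definition cover_filter : set_system X :=
  [set A | exists C, [/\ C `<=` D, finite_set C & ~` (\bigcup_(U in C) U) `<=` A]].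

Lemma cover_filter_filter : Filter cover_filter.
Proof.
split.
- by exists set0; split.
- move=> A B [C [CD finC CA]] [C' [C'D finC' C'B]].
  exists (C `|` C'); split; first by rewrite subUset.
    by rewrite finite_setU.
  by rewrite bigcup_setU setCU; exact: setISS.
- by move=> A B AB [C [CD finC CA]]; exists C; split=> //; exact: subset_trans AB.
Qed.

(** Each [V] in [C] grows first to its closure, then to a larger member [g V] of [D]. The complement
    of the closures is the open member sought. *)
Lemma cover_filter_regular :
  D `<=` open -> shrinkable_refinement D D -> regular_filter cover_filter.
Proof.
move=> Dopen Dshr A [C [CD finC CA]].
have /choice[g gP] : forall V, exists U, D V -> D U /\ closure V `<=` U.
  move=> V; have [/Dshr[U DU VU]|nDV] := pselect (D V); first by exists U.
  by exists set0.
have cC : closed (\bigcup_(V in C) closure V).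
  by apply: closed_bigcup => // V _; exact: closed_closure.
exists (~` (\bigcup_(V in C) closure V)); split; first exact: closed_openC.
  exists (g @` C); split; first by move=> _ [V /CD/gP[]? _ <-].
    exact: finite_image.
  apply: subsetC => x [V CV Vx]; exists (g V); first by exists V.
  by have [_] := gP V (CD _ CV); exact.
apply: subset_trans CA; apply: closure_subset_closed.
  by apply: open_closedC; apply: bigcup_open => V /CD/Dopen.
by apply: subsetC => x [V CV Vx]; exists V => //; exact: subset_closure.
Qed.

Lemma cluster_cover_filter :
  D `<=` open -> cluster cover_filter `<=` ~` (\bigcup_(V in D) V).
Proof.
move=> Dopen x + [V DV Vx]; rewrite clusterE => /(_ (~` V)).
rewrite -((closure_id _).1 (open_closedC (Dopen _ DV))); apply=> //.
exists [set V]; split; [by move=> _ ->|exact: finite_set1|].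
by rewrite bigcup_set1.
Qed.

End CoverFilter.

Lemma minimal_regular_complete_accumulation (X : topologicalType) (A : set X)
    (x : X) : minimal_regular X -> ~ theta_omega_converges A (~` [set x]) ->
  complete_accumulation A x.
Proof.
move=> Xmin /existsNP[G /not_implyP[[[Gopen _] [D [[Dopen Dcov] [DG Dshr]]]] nG]].
have FD := cover_filter_filter D.
have xD : nbhs x `<=` cover_filter D.
  apply: minimal_regular_cvg => //; first exact: cover_filter_regular.
  move=> y /(cluster_cover_filter Dopen) Dy; apply: contrapT => yx.
  by apply: Dy; exact: Dcov.
move=> U /open_nbhs_nbhs/xD[C [CD finC CU]].
have /choice[g gP] : forall V, exists W, D V -> G W /\ V `<=` W.
  move=> V; have [/DG[W GW VW]|nDV] := pselect (D V); first by exists W.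
  by exists set0.
rewrite card_eq_le subset_card_le//=; apply: contrapT => /negP AU.
apply: nG; exists (g @` C); split; first by move=> _ [V /CD/gP[]? _ <-].
  exact: finite_image.
(* What the chosen members of [G] leave of [A] lies in [U], so a smaller trace of [A] on [U] would
   give convergence. *)
rewrite /card_lt subset_card_le//=; apply: contra AU => /card_le_trans; apply.
apply: subset_card_le => y [Ay gy]; split=> //; apply: CU => -[V CV Vy].
apply: gy; exists (g V); first by exists V.
by have [_] := gP V (CD _ CV); exact.
Qed.

(** * Regular filters with at most one cluster point *)

Section ClusterPoint.
Context {X : topologicalType} (E : set_system X) (p : X).
Hypotheses (FE : Filter E) (E_reg : regular_filter E).
Hypothesis E_p : cluster E `<=` [set p].

Lemma infinite_set_meets_filter (U : set X) :
  U p -> (forall G, E G -> ~ G `<=` U) ->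
  exists A, [/\ infinite_set A, A `&` U = set0 & forall G, E G -> A #<= A `&` G].
Proof.
move=> Up EU.
have [[G0 EG0] Gmin] := card_le_minimum (fun G : {G | E G} => sval G `\` U)
  (exist _ setT filterT).
exists (G0 `\` U); split; last first.
- move=> G EG; have := Gmin (exist _ (G0 `&` G) (@filterI _ _ FE _ _ EG0 EG)).
  by rewrite /= setIDAC setIDA.
- by rewrite setDE -setIA setICl setI0.
move=> finG0U.
have /choice[g gP] : forall x, exists V, ~ U x -> E V /\ ~ V x.
  move=> x; have [Ux|nUx] := pselect (U x); first by exists setT.
  have /(not_clusterP E_reg)[V [_ EV Vx]] : ~ cluster E x.
    by move=> /E_p xp; apply: nUx; rewrite xp.
  by exists V => _; split=> // /subset_closure.
have EI : E (G0 `&` \bigcap_(x in G0 `\` U) g x).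
  by apply: filterI => //; apply: filter_bigcap_finite => // x [_ /gP[]].
apply: (EU _ EI) => x [G0x gx]; apply: contrapT => nUx.
by have [_] := gP _ nUx; apply; exact: gx.
Qed.

(** Complements of closures of members of [E] cover all but [p], and regularity of [E] makes this
    cover its own regular refinement. Finitely many of them miss a member of [E], on which [A] has a
    trace of full size. *)
Lemma not_theta_omega_converges (A : set X) : (forall G, E G -> A #<= A `&` G) ->
  ~ theta_omega_converges A (~` [set p]).
Proof.
move=> AE; pose C := [set ~` closure G | G in E].
have Ccov : open_cover (~` [set p]) C.
  split; first by move=> _ [G _ <-]; exact/closed_openC/closed_closure.
  move=> x xp; have /(not_clusterP E_reg)[V [_ EV Vx]] : ~ cluster E x by move=> /E_p.
  by exists (~` closure V) => //; exists V.
have Cshr : shrinkable_refinement C C.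
  move=> _ [G EG <-]; have EG' := regular_filter_interior FE E_reg EG.
  have [V [oV EV VG]] := E_reg EG'.
  exists (~` closure V); first by exists V.
  rewrite closure_setC; apply: subsetC; apply: subset_trans VG _.
  exact/interiorS/subset_closure.
move=> /(_ C)[].
  by split=> //; exists C; split=> //; split=> // V CV; exists V.
move=> D [DC finD]; rewrite /card_lt => /andP[_ /negP]; apply.
have ED : E (\bigcap_(V in D) ~` V).
  apply: filter_bigcap_finite => // V /DC[G EG <-].
  by rewrite setCK; apply: filterS EG; exact: subset_closure.
apply: (card_le_trans (AE _ ED)); apply: subset_card_le => x [Ax Dx].
by split=> // -[V /Dx].
Qed.

Lemma R_closed_theta_omega_accumulation (A : set X) : R_closed X ->
  (forall G, E G -> A #<= A `&` G) -> theta_omega_accumulation A p.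
Proof.
move=> Xcl AE H [_ [V VP]].
have [i [G [EG GV]]] : exists i G, E G /\ A `&` G `<=` V i.
  apply: contrapT => noV.
  have Vmono i j : (i <= j)%N -> V i `<=` V j.
    move=> /subnK <-; elim: (j - i)%N => // k IHk; apply: (subset_trans IHk).
    by have [_ + _] := VP (k + i)%N; apply: subset_trans; exact: subset_closure.
  (* The traces of [E] on the complements of the [V i] would form a regular filter
     without cluster point. *)
  pose E' : set_system X := [set B | exists i G, E G /\ G `\` V i `<=` B].
  have PE' : ProperFilter E'.
    split.
      move=> [i [G [EG GV]]]; apply: noV; exists i, G; split=> // x [_ Gx].
      by apply: contrapT => Vx; exact: (GV x).
    split.
    - by exists 0%N, setT; split=> //; exact: filterT.
    - move=> B C [i [G [EG GB]]] [j [K [EK KC]]].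
      exists (maxn i j), (G `&` K); split; first exact: filterI.
      move=> x [[Gx Kx] Vx]; split; [apply: GB|apply: KC]; split=> // Vx'.
        by apply: Vx; apply: Vmono Vx'; exact: leq_maxl.
      by apply: Vx; apply: Vmono Vx'; exact: leq_maxr.
    - move=> B C BC [i [G [EG GB]]]; exists i, G; split=> //.
      exact: subset_trans BC.
  have E'_reg : regular_filter E'.
    move=> B [i [G [EG GB]]]; have [W [oW EW WG]] := E_reg EG.
    (* Removing [closure (V i.+1)] removes less than [V i.+2], so the set is in [E']; its closure
       still misses the open set [V i.+1], hence [V i]. *)
    exists (W `\` closure (V i.+1)); split.
    - by apply: openI => //; exact/closed_openC/closed_closure.
    - have [_ clV _] := VP i.+1.
      by exists i.+2, W; split=> // x [Wx Vx]; split=> // /clV.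
    - apply: subset_trans GB => x /closureI[/WG Gx].
      rewrite closure_setC => Vx; split=> // Vix; apply: Vx.
      have [[oV _] _ _] := VP i.+1.
      have : V i.+1 `<=` (closure (V i.+1))°.
        by rewrite -open_subsetE//; exact: subset_closure.
      by apply; exact: Vmono Vix.
  have [x E'x] := R_closed_cluster PE' Xcl E'_reg.
  (* As [E'] refines [E], only [p] can be a cluster point, but the neighborhood [V 0] of [p] is
     disjoint from a member of [E']. *)
  have xp : x = p.
    by apply: E_p; apply: cvg_cluster E'x => B EB; exists 0%N, B; split=> // ? [].
  have [[oV Vp] _ _] := VP 0%N.
  have [||y []//] := E'x (~` V 0%N) (V 0%N).
    by exists 0%N, setT; split; [exact: filterT|move=> ? []].
  by rewrite xp; exact: open_nbhs_nbhs.
rewrite card_eq_le subset_card_le//=; apply: (card_le_trans (AE _ EG)).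
apply: subset_card_le => x AGx; split; first by case: AGx.
by have [_ _] := VP i; apply; exact: GV.
Qed.

End ClusterPoint.

Theorem theorem7p5 (X : topologicalType) (X_regular : regular_hausdorff X) :
  minimal_regular X <->
  R_closed X /\
  forall A : set X, infinite_set A ->
    let B := [set x | theta_omega_accumulation A x] in
    forall x : X, B x -> ~ theta_omega_converges A (~` [set x]) ->
      complete_accumulation A x.
Proof.
split=> [Xmin|[Xcl Xacc]].
  split=> [|A _ B x _]; first exact: minimal_regular_R_closed.
  exact: minimal_regular_complete_accumulation.
split=> // -[tau [X'_rh [opens nopen]]].
pose X' : topologicalType := Topological.Pack tau.
have cl' (A : set X) : closure A `<=` @closure X' A.
  apply: closure_subset_closed; last exact: (@subset_closure X').
  rewrite -(setCK (@closure X' A)); apply: open_closedC; apply: opens.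
  exact/(@closed_openC X')/(@closed_closure X').
apply: nopen => U oU; rewrite (@openE X') => p Up; apply: contrapT => npU.
(* Coarse open sets are open in [X] and coarse closures are larger, so regularity and separation in
   [X'] carry over to [E] as a filter on [X]. *)
pose E : set_system X := @nbhs X' X' p.
have FE : Filter E by exact: (@nbhs_filter X' p).
have E_reg : regular_filter E.
  move=> A /(@regular_open_nbhs X' _ _ X'_rh.1)[V [[oV Vp] VA]].
  exists V; split; [exact: opens|exact: (@open_nbhs_nbhs X')|].
  by apply: subset_trans VA.
have E_p : cluster E `<=` [set p].
  move=> x; rewrite clusterE => Ex; apply/esym/(X'_rh.2 p x).
  by rewrite (@clusterE X') => A /Ex /cl'.
have [|A [infA AU AE]] := infinite_set_meets_filter FE E_reg E_p Up.
  by move=> G EG GU; apply: npU; exact: filterS EG.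
(* The condition applies to [A] and [p], yet the neighborhood [U] of [p] misses [A]. *)
have := Xacc A infA p
  (R_closed_theta_omega_accumulation FE E_reg E_p Xcl AE)
  (not_theta_omega_converges FE E_reg E_p AE) U (conj oU Up).
by rewrite AU card_eq_sym card_eq0 => /eqP A0; apply: infA; rewrite A0.
Qed.
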